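(* Consider the sparse linear Gaussian model: $S\in\{1,\dots,N\}$, $\mathcal{X}_S=\{\mathbf{x}\in\mathbb{R}^N:\|\mathbf{x}\|_0\le S\}$, $\mathbf{H}\in\mathbb{R}^{M\times N}$ with $\operatorname{spark}(\mathbf{H})>S$, $\sigma>0$, observation $\mathbf{y}=\mathbf{H}\mathbf{x}+\mathbf{n}$, $\mathbf{n}\sim\mathcal{N}(\mathbf{0},\sigma^2\mathbf{I})$, and parameter function $g(\mathbf{x})=x_k$ for a fixed $k\in[N]$. Let $D=\operatorname{rank}(\mathbf{H})$, $\mathbf{H}=\mathbf{U}\mathbf{\Sigma}\mathbf{V}^T$ a thin SVD and $\widetilde{\mathbf{H}}=\mathbf{V}\mathbf{\Sigma}^{-1}$. Let $\mathbf{x}_1\in\mathbb{R}^D$, $C\ge 0$, and let $(a[\mathbf{p}])_{\mathbf{p}\in\mathbb{Z}_+^D}$ satisfy $|a[\mathbf{p}]|\le C^{|\mathbf{p}|}$ for all $\mathbf{p}$. Then the function $$c(\mathbf{x})=\exp\big(\mathbf{x}_1^T\widetilde{\mathbf{H}}^{\dagger}\mathbf{x}\big)\sum_{\mathbf{p}\in\mathbb{Z}_+^D}\frac{a[\mathbf{p}]}{\mathbf{p}!}\Big(\tfrac{1}{\sigma}\widetilde{\mathbf{H}}^{\dagger}\mathbf{x}\Big)^{\mathbf{p}}-x_k,\qquad \mathbf{x}\in\mathcal{X}_S,$$ is a valid bias function at every $\mathbf{x}_0\in\mathcal{X}_S$. In particular, for $\mathbf{H}=\mathbf{I}$ (with thin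 SVD $\mathbf{U}=\mathbf{V}=\mathbf{\Sigma}=\mathbf{I}$), the choice $\mathbf{x}_1=\mathbf{0}$, $a[\mathbf{e}_k]=\sigma$ and $a[\mathbf{p}]=0$ for all other $\mathbf{p}$ yields $c\equiv 0$.
   Context: $[N]=\{1,\dots,N\}$; $\|\mathbf{x}\|_0$ = number of nonzero entries; $\operatorname{spark}$ = minimum number of linearly dependent columns; $\dagger$ = Moore–Penrose pseudoinverse. Thin SVD: $\mathbf{U}\in\mathbb{R}^{M\times D}$, $\mathbf{V}\in\mathbb{R}^{N\times D}$ with orthonormal columns, $\mathbf{\Sigma}$ diagonal positive. Multi-index notation: $|\mathbf{p}|=\sum p_l$, $\mathbf{p}!=\prod p_l!$, $\mathbf{z}^{\mathbf{p}}=\prod z_l^{p_l}$; $\mathbf{e}_k$ is the $k$th unit multi-index. An estimator $\hat g:\mathbb{R}^M\to\mathbb{R}$ has bias $b(\hat g;\mathbf{x})=\mathsf{E}_{\mathbf{x}}\{\hat g(\mathbf{y})\}-x_k$ and variance $v(\hat g;\mathbf{x})$; a bias function $c:\mathcal{X}_S\to\mathbb{R}$ is valid at $\mathbf{x}_0$ if some estimator has $v(\hat g;\mathbf{x}_0)<\infty$ and $b(\hat g;\mathbf{x})=c(\mathbf{x})$ for all $\mathbf{x}\in\mathcal{X}_S$. *)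

(* Defs.v *)
From HB Require Import structures.
From mathcomp Require Import all_boot all_order all_algebra.
From mathcomp Require Import all_classical all_reals all_analysis.
Set Implicit Arguments. Unset Strict Implicit. Unset Printing Implicit Defensive.
Import Order.TTheory GRing.Theory Num.Theory.
Local Open Scope ring_scope.

Section Defs.
Variable R : realType.

Definition l0 (N : nat) (x : 'cV[R]_N) : nat := #|[set i | x i 0 != 0]|.
Definition sparse_set (N S : nat) : set 'cV[R]_N := [set x | (l0 x <= S)%N].

Definition cols_dependent (M N : nat) (H : 'M[R]_(M, N)) (T : {set 'I_N}) : Prop :=
  exists x : 'cV[R]_N, x != 0 /\ (forall i, i \notin T -> x i 0 = 0) /\ H *m x = 0.
(** spark(H) > S : the minimum number of linearly dependent columns exceeds S
    (vacuous if no set of columns is dependent, i.e. spark = +oo) *)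
Definition spark_gt (M N : nat) (H : 'M[R]_(M, N)) (S : nat) : Prop :=
  forall T : {set 'I_N}, cols_dependent H T -> (S < #|T|)%N.

Definition thin_svd (M N D : nat) (H : 'M[R]_(M, N)) (U : 'M[R]_(M, D))
  (Sig : 'M[R]_D) (V : 'M[R]_(N, D)) : Prop :=
  [/\ U^T *m U = 1%:M, V^T *m V = 1%:M, is_diag_mx Sig,
      (forall i, 0 < Sig i i) & H = U *m Sig *m V^T].

Definition is_MP_pinv (m n : nat) (A : 'M[R]_(m, n)) (B : 'M[R]_(n, m)) : Prop :=
  [/\ A *m B *m A = A, B *m A *m B = B, (A *m B)^T = A *m B & (B *m A)^T = B *m A].

Definition mindex (D : nat) := {ffun 'I_D -> nat}.
Definition mabs (D : nat) (p : mindex D) : nat := (\sum_(l < D) p l)%N.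
Definition mfact (D : nat) (p : mindex D) : nat := (\prod_(l < D) (p l)`!)%N.
Definition mpow (D : nat) (z : 'cV[R]_D) (p : mindex D) : R := \prod_(l < D) z l 0 ^+ p l.
Definition unit_mindex (D : nat) (k : 'I_D) : mindex D := [ffun l => nat_of_bool (l == k)].

Definition msum (D : nat) (f : mindex D -> R) : R :=
  fine (\esum_(p in [set: mindex D]) (Num.max (f p) 0)%:E
      - \esum_(p in [set: mindex D]) (Num.max (- f p) 0)%:E)%E.

(** the candidate bias function c(x), with Hp = Htilde^dagger *)
Definition bias_c (N D : nat) (sigma : R) (k : 'I_N) (Hp : 'M[R]_(D, N))
  (x1 : 'cV[R]_D) (a : mindex D -> R) (x : 'cV[R]_N) : R :=
  expR ((x1^T *m Hp *m x) 0 0) *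
  msum (fun p => a p / (mfact p)%:R * mpow (sigma^-1 *: (Hp *m x)) p) - x k 0.

(** Gaussian expectation: iterated integral over independent coordinates
    y_i ~ N(m_i, s^2) *)
Fixpoint gauss_iter (s : R) (n : nat) : n.-tuple R -> (n.-tuple R -> \bar R) -> \bar R :=
  match n with
  | 0 => fun _ f => f [tuple]
  | n'.+1 => fun m f =>
      (\int[normal_prob (thead m) s]_t
         gauss_iter s (behead_tuple m) (fun u => f [tuple of t :: u]))%E
  end.

Definition tup2col (n : nat) (t : n.-tuple R) : 'cV[R]_n := \col_i tnth t i.
Definition col2tup (n : nat) (v : 'cV[R]_n) : n.-tuple R := [tuple v i 0 | i < n].

(** E_x { f(y) } with y = H x + n, n ~ N(0, sigma^2 I) *)
Definition Egauss (M N : nat) (H : 'M[R]_(M, N)) (sigma : R) (x : 'cV[R]_N)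
  (f : 'cV[R]_M -> \bar R) : \bar R :=
  gauss_iter sigma (col2tup (H *m x)) (fun t => f (tup2col t)).

Definition est_mean M N (H : 'M[R]_(M, N)) sigma x (g : 'cV[R]_M -> R) : R :=
  fine (Egauss H sigma x (fun y => (g y)%:E)).
Definition est_var M N (H : 'M[R]_(M, N)) sigma x (g : 'cV[R]_M -> R) : \bar R :=
  Egauss H sigma x (fun y => ((g y - est_mean H sigma x g) ^+ 2)%:E).
Definition est_bias M N (H : 'M[R]_(M, N)) sigma (k : 'I_N) x (g : 'cV[R]_M -> R) : R :=
  est_mean H sigma x g - x k 0.

Definition valid_bias (M N : nat) (H : 'M[R]_(M, N)) (sigma : R) (S : nat) (k : 'I_N)
  (c : 'cV[R]_N -> R) (x0 : 'cV[R]_N) : Prop :=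
  exists g : 'cV[R]_M -> R,
    [/\ measurable_fun [set: M.-tuple R] (fun t => g (tup2col t)),
        (forall x, sparse_set S x -> Egauss H sigma x (fun y => (`|g y|)%:E) < +oo)%E,
        (est_var H sigma x0 g < +oo)%E &
        (forall x, sparse_set S x -> est_bias H sigma k x g = c x)].

End Defs.

(* Main.v *)
(** Let [w = U^T y / sigma] and [mu = Htilde^+ x / sigma].  As [H x = U (Htilde^+ x)]
    and [U^T U = 1], the moment generating function of [w] is that of a standard
    Gaussian vector centred at [mu]:
    [E (prod_l exp (s_l w_l - s_l^2 / 2)) = prod_l exp (s_l mu_l)].  Differentiating
    [p_l] times in each [s_l] under the expectation gives
    [E (prod_l exp (s_l w_l - s_l^2 / 2) He_{p_l} (w_l - s_l))
       = prod_l mu_l^{p_l} exp (s_l mu_l)],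
    where [He_n] are the Hermite polynomials.  With [s = sigma x_1], the estimator
    [sum_p a_p / p! prod_l exp (s_l w_l - s_l^2 / 2) He_{p_l} (w_l - s_l)]
    therefore has the required mean, provided sum and expectation commute; this
    and all the moment conditions follow from
    [sum_n C^n / n! |He_n (x)| <= B exp (lam |x|)], which dominates the series by
    a function [A exp (K |y|_1)]. *)

Require Import Defs.
From HB Require Import structures.
From mathcomp Require Import all_boot all_order all_algebra.
From mathcomp Require Import all_classical all_reals all_analysis.
From mathcomp Require Import measurable_realfun ring lra.
Set Implicit Arguments. Unset Strict Implicit. Unset Printing Implicit Defensive.
Import Order.TTheory GRing.Theory Num.Theory.
Import numFieldNormedType.Exports.
Local Open Scope classical_set_scope.
Local Open Scope ring_scope.

(** * Exponential integrals against a one-dimensional normal law *)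

Section normal_integral.
Context {R : realType}.
Local Notation mu := (@lebesgue_measure R).
Implicit Types m s c : R.

(** The Radon-Nikodym derivative of [normal_prob] agrees almost everywhere with the density, because
    both have the same integral over every measurable set. *)
Lemma ge0_integral_normal_prob m s (f : R -> \bar R) :
  measurable_fun [set: R] f -> (forall x, 0 <= f x)%E ->
  (\int[normal_prob m s]_x f x = \int[mu]_x (f x * (normal_pdf m s x)%:E))%E.
Proof.
move=> mf f0.
have dom := @normal_prob_dominates R m s.
rewrite -(Radon_Nikodym_SigmaFinite.change_of_variables dom)//.
apply: ae_eq_integral => //.
- apply: emeasurable_funM => //; apply: (measurable_int mu).
  exact: Radon_Nikodym_SigmaFinite.f_integrable.
- apply: emeasurable_funM => //.
  by apply/measurable_EFinP; exact: measurable_normal_pdf.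
- apply: ae_eqe_mul2l => /=; apply: integral_ae_eq => //=.
  + exact: Radon_Nikodym_SigmaFinite.f_integrable.
  + by apply/measurable_EFinP; exact: measurable_normal_pdf.
  + by move=> E _ mE; rewrite -Radon_Nikodym_SigmaFinite.f_integral.
Qed.

(** Completing the square: an exponential tilt moves the mean by [c * s ^+ 2] and leaves the
    variance unchanged. *)
Lemma expR_normal_pdf m s c x : s != 0 ->
  expR (c * x) * normal_pdf m s x =
  expR (c * m + c ^+ 2 * s ^+ 2 / 2) * normal_pdf (m + c * s ^+ 2) s x.
Proof.
move=> s0; rewrite !normal_pdfE// mulrCA [RHS]mulrCA; congr *%R.
rewrite /normal_fun -!expRD; congr expR.
by rewrite -!(mulr_natl (_ ^+ 2)); field.
Qed.

Lemma normal_prob_mgf m s c : s != 0 ->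
  (\int[normal_prob m s]_x (expR (c * x))%:E =
   (expR (c * m + c ^+ 2 * s ^+ 2 / 2))%:E)%E.
Proof.
move=> s0; rewrite ge0_integral_normal_prob//; last first.
  by apply/measurable_EFinP; apply: measurableT_comp => //; exact: mulrl_measurable.
under eq_integral do rewrite -EFinM expR_normal_pdf// EFinM.
by rewrite integralZl ?integral_normal_pdf ?mule1//; exact: integrable_normal_pdf.
Qed.

(** Pointwise, [expR (c * |x|)] equals [expR (c * x)] or [expR (- c * x)], so it is at most the sum
    of two functions with finite integrals. *)
Lemma normal_prob_exp_norm_lty m s c : s != 0 ->
  (\int[normal_prob m s]_x (expR (c * `|x|))%:E < +oo)%E.
Proof.
move=> s0; have mexp (a : R) : measurable_fun [set: R] (fun x : R => (expR (a * x))%:E).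
  by apply/measurable_EFinP; apply: measurableT_comp => //; exact: mulrl_measurable.
apply: (@le_lt_trans _ _
  (\int[normal_prob m s]_x ((expR (c * x))%:E + (expR (- c * x))%:E))%E).
  apply: ge0_le_integral => //.
  - apply/measurable_EFinP; apply: measurableT_comp => //=.
    by apply: measurableT_comp => //; exact: mulrl_measurable.
  - by apply: emeasurable_funD; exact: mexp.
  -
    move=> x _; rewrite -EFinD lee_fin.
    have [x0|x0] := ger0P x; first by rewrite lerDl expR_ge0.
    by rewrite mulrN -mulNr lerDr expR_ge0.
rewrite ge0_integralD//; [|exact: mexp..].
by rewrite !normal_prob_mgf// -EFinD ltry.
Qed.

End normal_integral.

(** * The iterated Gaussian integral as integration against a probability measure *)

Section gauss_measure.
Context {R : realType}.

Definition norm1 n (t : n.-tuple R) : R := \sum_(i < n) `|tnth t i|.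

(** The growth class of the estimator: it has all Gaussian moments and is stable under freezing
    coordinates and squaring. *)
Definition exp_bounded n (f : n.-tuple R -> R) :=
  exists A K : R, forall t, `|f t| <= A * expR (K * norm1 t).

Lemma norm1_cons n (x : R) (t : n.-tuple R) :
  norm1 [tuple of x :: t] = `|x| + norm1 t.
Proof.
rewrite /norm1 big_ord_recl tnth0; congr (_ + _).
by apply: eq_bigr => i _; rewrite tnthS.
Qed.

Lemma norm1_ge0 n (t : n.-tuple R) : 0 <= norm1 t.
Proof. exact: sumr_ge0. Qed.

Lemma measurable_norm1 n : measurable_fun [set: n.-tuple R] (@norm1 n).
Proof.
apply: measurable_sum => i; apply: measurableT_comp => //.
exact: measurable_tnth.
Qed.

Lemma measurable_expR_norm1 n (K : R) :
  measurable_fun [set: n.-tuple R] (fun t => expR (K * norm1 t)).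
Proof.
apply: measurableT_comp => //; apply: measurable_funM => //.
exact: measurable_norm1.
Qed.

Definition tuple_cons n (z : R * n.-tuple R) : n.+1.-tuple R :=
  [tuple of z.1 :: z.2].

Lemma measurable_tuple_cons n :
  measurable_fun [set: measurableTypeR R * n.-tuple R] (@tuple_cons n).
Proof. by apply: measurable_cons. Qed.

Lemma measurable_cons_section d (T : measurableType d) n (f : n.+1.-tuple R -> T)
    (x : R) :
  measurable_fun setT f ->
  measurable_fun setT (fun u : n.-tuple R => f [tuple of x :: u]).
Proof.
move=> mf; apply: (measurableT_comp mf).
exact: (@measurable_cons _ _ _ _ (cst x) n id).
Qed.

(** Turns [gauss_iter] into a genuine integral, so that convergence theorems apply. By induction,
    the measure is the product of the first normal law with the measure of the remaining
    coordinates, transported by [tuple_cons]. The first clause is Tonelli. The second holds because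
    [expR (K * norm1 t)] factors over coordinates, and it supplies the integrability that Fubini
    requires in the third. *)
Lemma exists_gauss_measure (s : R) n (m : n.-tuple R) : s != 0 ->
  exists P : probability (n.-tuple R) R,
  [/\ forall f : n.-tuple R -> \bar R, measurable_fun setT f ->
        (forall t, 0 <= f t)%E -> gauss_iter s m f = (\int[P]_t f t)%E,
      forall K : R, (\int[P]_t (expR (K * norm1 t))%:E < +oo)%E &
      forall f : n.-tuple R -> R, measurable_fun setT f -> exp_bounded f ->
        gauss_iter s m (EFin \o f) = (\int[P]_t (f t)%:E)%E].
Proof.
move=> s0; elim: n m => [|n IH] m.
  have int0 (f : 0.-tuple R -> \bar R) : measurable_fun setT f ->
      (\int[\d_ ([tuple] : 0.-tuple R)]_t f t = f [tuple])%E.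
    by move=> mf; rewrite integral_dirac// diracT mul1e.
  exists (\d_ ([tuple] : 0.-tuple R)); split => [f mf _|K|f mf _].
  - by rewrite int0.
  - rewrite int0 ?ltry//; apply/measurable_EFinP; exact: measurable_expR_norm1.
  - by rewrite int0//; exact/measurable_EFinP.
have [P0 [P01 P02 P03]] := IH (behead_tuple m).
pose N : probability (measurableTypeR R) R := normal_prob (thead m) s.
pose Q := (N \x P0)%E : probability _ R.
pose X : {RV Q >-> n.+1.-tuple R} := MeasurableFun.Pack (MeasurableFun.Class
  (isMeasurableFun.Build _ _ _ _ _ (@measurable_tuple_cons n))).
pose P : probability (n.+1.-tuple R) R := distribution Q X.
have mX (f : n.+1.-tuple R -> \bar R) : measurable_fun setT f ->
    measurable_fun setT (f \o X).
  by move=> mf; exact: measurableT_comp.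
have P1 (f : n.+1.-tuple R -> \bar R) : measurable_fun setT f ->
    (forall t, 0 <= f t)%E -> gauss_iter s m f = (\int[P]_t f t)%E.
  move=> mf f0; rewrite ge0_integral_distribution// fubini_tonelli1//=; last first.
    exact: mX.
  apply: eq_integral => x _; rewrite P01//.
  exact: measurable_cons_section.
have mE K : measurable_fun [set: n.+1.-tuple R] (fun t => (expR (K * norm1 t))%:E).
  by apply/measurable_EFinP; exact: measurable_expR_norm1.
have P2 (K : R) : (\int[P]_t (expR (K * norm1 t))%:E < +oo)%E.
  rewrite -P1//=.
  have iE x : gauss_iter s (behead_tuple m)
      (fun u => (expR (K * norm1 [tuple of x :: u]))%:E) =
      ((\int[P0]_t (expR (K * norm1 t))%:E) * (expR (K * `|x|))%:E)%E.
    rewrite P01//; last first.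
      apply/measurable_EFinP; apply: measurableT_comp => //.
      apply: measurable_funM => //.
      under eq_fun do rewrite norm1_cons.
      by apply: measurable_funD => //; exact: measurable_norm1.
    rewrite muleC -ge0_integralZl//; last first.
      by apply/measurable_EFinP; exact: measurable_expR_norm1.
    by apply: eq_integral => u _; rewrite norm1_cons mulrDr expRD EFinM.
  under eq_integral do rewrite iE.
  rewrite ge0_integralZl//; last 2 first.
  - apply/measurable_EFinP; apply: measurableT_comp => //.
    by apply: measurable_funM => //; exact: measurableT_comp.
  - by apply: integral_ge0.
  rewrite lte_mul_pinfty//; last exact: normal_prob_exp_norm_lty.
  - by apply: integral_ge0.
  - by rewrite ge0_fin_numE//; apply: integral_ge0.
exists P; split => // f mf [A [K fAK]].
have mEf : measurable_fun setT (EFin \o f) by exact/measurable_EFinP.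
have intf : P.-integrable setT (EFin \o f).
  apply: (@le_integrable _ _ _ _ _ _ _
    (fun t => A%:E * (expR (K * norm1 t))%:E)%E) => //.
    by move=> t _; rewrite -EFinM /= lee_fin (le_trans (fAK t))// ler_norm.
  apply: integrableZl => //; apply/integrableP; split => //.
  by under eq_integral do rewrite gee0_abs//.
have intfX : Q.-integrable setT (EFin \o f \o X).
  apply/integrableP; split; first exact: mX.
  have /integrableP[_] := intf; rewrite ge0_integral_distribution//.
  exact: measurableT_comp.
rewrite integral_distribution// -[RHS]integral12_prod_meas1//.
apply: eq_integral => x _.
(* Freezing the first coordinate at [x] only enlarges the constant, by the factor [expR (K * |x|)],
   so the section is again [exp_bounded]. *)
apply: (P03 (fun u : n.-tuple R => f [tuple of x :: u])).
- exact: measurable_cons_section.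
- exists (A * expR (K * `|x|)), K => t.
  by rewrite (le_trans (fAK _))// norm1_cons mulrDr expRD mulrA.
Qed.

End gauss_measure.

(** * Moment generating function of a Gaussian vector *)

Section gauss_mgf.
Context {R : realType}.

(** The constant [c] makes the induction go through: in the inner integral it absorbs the
    exponential of the outer coordinate. *)
Lemma gauss_iter_mgf (s : R) n (m : n.-tuple R) (v : 'I_n -> R) (c : R) :
  s != 0 -> 0 <= c ->
  gauss_iter s m (fun t => (c * expR (\sum_i v i * tnth t i))%:E) =
  (c * expR (\sum_i (v i * tnth m i + v i ^+ 2 * s ^+ 2 / 2)))%:E.
Proof.
move=> s0; elim: n m v c => [|n IH] m v c c0 /=; first by rewrite !big_ord0.
have inner x : gauss_iter s (behead_tuple m) (fun u =>
      (c * expR (\sum_i v i * tnth [tuple of x :: u] i))%:E) =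
    ((c * expR (\sum_i (v (lift ord0 i) * tnth (behead_tuple m) i +
       v (lift ord0 i) ^+ 2 * s ^+ 2 / 2)))%:E * (expR (v ord0 * x))%:E)%E.
  rewrite -EFinM mulrAC -IH ?mulr_ge0 ?expR_ge0//.
  congr gauss_iter; apply/funext => u; rewrite big_ord_recl tnth0 expRD mulrA.
  by congr (_ * expR _)%:E; apply: eq_bigr => i _; rewrite tnthS.
under eq_integral do rewrite inner.
rewrite ge0_integralZl_EFin//; last 2 first.
- apply/measurable_EFinP; apply: measurableT_comp => //; exact: mulrl_measurable.
- by rewrite mulr_ge0 ?expR_ge0.
rewrite normal_prob_mgf// -EFinM -(mulrA c) -expRD [in RHS]big_ord_recl addrC.
congr (_ * expR (_ + _))%:E.
by apply: eq_bigr => i _; rewrite [in RHS](tuple_eta m) tnthS.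
Qed.

End gauss_mgf.

(** * Hermite polynomials and their growth *)

Section hermite.
Context {R : realType}.
Implicit Types (n N : nat) (s w x C lam : R).

(** The probabilists' polynomials He_n, generated by He_{n+1} = X He_n - He_n'. *)
Definition hermite n : {poly R} := iter n (fun p => 'X * p - p^`()) 1.

(** This is the [n]-th derivative in [s] of the generating function exp(s w - s^2/2). *)
Definition hermite_exp s n w : R :=
  expR (s * w - s ^+ 2 / 2) * (hermite n).[w - s].

(** Differentiating the exponential gives the factor [w - s], and the chain rule on the polynomial
    gives -He_n'(w - s); together they form the Hermite recurrence. *)
Lemma is_derive_hermite_exp s n w :
  is_derive s 1 (fun s => hermite_exp s n w) (hermite_exp s n.+1 w).
Proof.
have dsub : is_derive s 1 (fun s => w - s) (- 1).
  apply: (is_derive_eq (is_deriveB (is_derive_cst w s 1) (is_derive_id s 1))).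
  by rewrite sub0r.
have dexp : is_derive s 1 (fun s => s * w - s ^+ 2 / 2) (w - s).
  have dX := is_deriveM (is_derive_id s 1) (is_derive_cst (w : R) s 1).
  have dX2 := is_deriveM (is_deriveX 2 (is_derive_id s 1)) (is_derive_cst (2^-1 : R) s 1).
  rewrite [X in is_derive _ _ X](_ : _ = id * cst w - id ^+ 2 * cst 2^-1);
    last by apply/funext => u; rewrite !fctE.
  apply: (is_derive_eq (is_deriveB dX dX2)).
  by rewrite /GRing.scale /=; field.
have d1 := is_derive1_comp (is_derive_expR _) dexp.
have d2 := @is_derive1_comp _ _ (fun s => w - s) _ _ _ (is_derive_poly (hermite n) _) dsub.
have -> : (fun s => hermite_exp s n w) = (expR \o (fun s => s * w - s ^+ 2 / 2)) *
  (horner (hermite n) \o (fun s => w - s)) by apply/funext.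
apply: (is_derive_eq (is_deriveM d1 d2)).
by rewrite /hermite_exp /= !hornerE /GRing.scale /=; ring.
Qed.

Lemma measurable_hermite_exp s n : measurable_fun [set: R] (hermite_exp s n).
Proof.
apply: measurable_funM.
  by apply: measurableT_comp => //; apply: measurable_funB.
apply: (@measurableT_comp _ _ _ _ _ _ (horner (hermite n))); first exact: measurable_poly.
exact: measurable_funB.
Qed.

Lemma size_hermite n : (size (hermite n) <= n.+1)%N.
Proof.
elim: n => [|n IH]; first by rewrite size_poly1.
rewrite [hermite _]/= (leq_trans (size_polyD _ _))// size_polyN geq_max.
rewrite (leq_trans (size_polyMleq _ _)) ?size_polyX//=.
have [->|/lt_size_deriv/ltnW/leq_trans] := eqVneq (hermite n) 0.
  by rewrite deriv0 size_poly0.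
by apply; exact: leqW.
Qed.

Definition hermite_coef_bound lam n : R := \prod_(j < n) (j.+1%:R / lam + lam).

Lemma hermite_coef_bound_ge0 lam n : 0 < lam -> 0 <= hermite_coef_bound lam n.
Proof.
by move=> lam0; apply: prodr_ge0 => i _; rewrite addr_ge0 ?divr_ge0 ?ltW.
Qed.

(** The coefficients are compared with those of exp(lam x). On lam^i / i!, multiplication by X costs
    a factor i / lam and differentiation a factor lam, which explains the factors of
    [hermite_coef_bound]. *)
Lemma coef_hermite_le lam n i : 0 < lam ->
  `|(hermite n)`_i| <= hermite_coef_bound lam n * (lam ^+ i / i`!%:R).
Proof.
move=> lam0; have lamN0 : lam != 0 by rewrite gt_eqF.
have q0 j : 0 <= lam ^+ j / j`!%:R by rewrite divr_ge0 ?exprn_ge0 ?ltW.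
elim: n i => [|n IH] i.
  rewrite /hermite_coef_bound big_ord0 mul1r coef1.
  by case: i => [|i] /=; rewrite ?normr0// normr1 expr0 fact0 divr1.
have A0 := hermite_coef_bound_ge0 n lam0.
(* Beyond the degree the coefficient vanishes; otherwise [i <= n.+1], which bounds the cost i / lam
   uniformly in [i]. *)
have [ni|ni] := ltnP n.+1 i.
  rewrite nth_default ?(leq_trans (size_hermite _))// normr0.
  by rewrite mulr_ge0 ?hermite_coef_bound_ge0.
rewrite [hermite n.+1]/= coefB coefXM coef_deriv.
rewrite /hermite_coef_bound big_ord_recr /= -/(hermite_coef_bound lam n) -mulrA.
apply: (le_trans (ler_normB _ _)).
rewrite mulrDl mulrDr; apply: lerD.
  case: i ni => [|i] ni /=; first by rewrite normr0 mulr_ge0// mulr_ge0// divr_ge0// ltW.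
  apply: (le_trans (IH i)); rewrite ler_wpM2l//.
  have i0 : (0 : R) < i.+1%:R by rewrite ltr0n.
  have -> : lam ^+ i / i`!%:R = i.+1%:R / lam * (lam ^+ i.+1 / i.+1`!%:R).
    rewrite exprS factS natrM; field.
    by rewrite lamN0 !pnatr_eq0 -lt0n fact_gt0/= andbT.
  apply: ler_wpM2r => //; apply: ler_wpM2r; last by rewrite ler_nat.
  by rewrite invr_ge0 ltW.
have -> : lam * (lam ^+ i / i`!%:R) = lam ^+ i.+1 / i.+1`!%:R * i.+1%:R.
  rewrite exprS factS natrM; field.
  by rewrite nat1r !pnatr_eq0 -lt0n fact_gt0.
by rewrite normrMn -[leLHS]mulr_natr mulrA ler_wpM2r.
Qed.

Lemma exp_partial_sum_le x N : 0 <= x ->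
  \sum_(i < N) x ^+ i / i`!%:R <= expR x.
Proof.
move=> x0; rewrite -(big_mkord xpredT (fun i => x ^+ i / i`!%:R)).
apply: (@nondecreasing_cvgn_le _ (series (exp_coeff x))).
  by apply: nondecreasing_series => n _ _; exact: exp_coeff_ge0.
exact: is_cvg_series_exp_coeff.
Qed.

Lemma hermite_le lam n x : 0 < lam ->
  `|(hermite n).[x]| <= hermite_coef_bound lam n * expR (lam * `|x|).
Proof.
move=> lam0; rewrite (horner_coef_wide _ (size_hermite n)).
apply: (le_trans (ler_norm_sum _ _ _)).
apply: (@le_trans _ _ (hermite_coef_bound lam n *
    \sum_(i < n.+1) (lam * `|x|) ^+ i / i`!%:R)).
  rewrite mulr_sumr; apply: ler_sum => i _.
  rewrite normrM normrX exprMn [_ * _ / _]mulrAC mulrA ler_wpM2r ?exprn_ge0//.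
  exact: coef_hermite_le.
rewrite ler_wpM2l ?hermite_coef_bound_ge0// exp_partial_sum_le//.
by rewrite mulr_ge0// ltW.
Qed.

(* With [lam = 4 C + 1] consecutive terms of the majorant
   [C^n / n! * hermite_coef_bound lam n] have ratio at most [1/2] eventually. *)
Lemma hermite_egf_le C : 0 <= C -> exists lam B : R,
  [/\ 0 <= lam, 0 <= B & forall N x,
    \sum_(n < N) C ^+ n / n`!%:R * `|(hermite n).[x]| <= B * expR (lam * `|x|)].
Proof.
move=> C0; pose lam : R := 4 * C + 1.
have lam0 : 0 < lam by rewrite /lam; lra.
pose q n : R := C ^+ n / n`!%:R * hermite_coef_bound lam n.
have q0 n : 0 <= q n.
  by rewrite mulr_ge0 ?hermite_coef_bound_ge0// divr_ge0 ?exprn_ge0.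
have qS n : q n.+1 = (C / lam + C * lam / n.+1%:R) * q n.
  rewrite /q /hermite_coef_bound big_ord_recr /= exprS factS natrM.
  by field; rewrite nat1r !pnatr_eq0 -lt0n fact_gt0 (gt_eqF lam0).
pose L := Num.bound (4 * C * lam).
have qL n : (L <= n)%N -> q n.+1 <= q n / 2.
  move=> Ln; rewrite qS mulrC ler_wpM2l//.
  have h1 : C / lam <= 1 / 4 by rewrite ler_pdivrMr// /lam; lra.
  have h2 : C * lam / n.+1%:R <= 1 / 4.
    rewrite ler_pdivrMr ?ltr0n//.
    have : 4 * C * lam < n.+1%:R.
      rewrite (lt_le_trans (archi_boundP _))//; last by rewrite ler_nat ltnW.
      by rewrite !mulr_ge0// ltW.
    lra.
  by apply: (le_trans (lerD h1 h2)); lra.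
pose B := \sum_(n < L) q n + 2 * q L.
have B0 : 0 <= B by apply: addr_ge0; [exact: sumr_ge0|rewrite mulr_ge0].
have sumq N : \sum_(n < N) q n <= B.
  (* Terms from [L] on at least halve, so a partial sum plus twice its next term never increases. *)
  have sumLk k : \sum_(n < L + k) q n + 2 * q (L + k)%N <= B.
    elim: k => [|k IH]; first by rewrite addn0.
    rewrite addnS big_ord_recr /=; apply: le_trans IH.
    have := qL (L + k)%N (leq_addr _ _); lra.
  have [LN|NL] := leqP L N.
    rewrite -(subnKC LN); apply: le_trans (sumLk (N - L)%N).
    by rewrite lerDl mulr_ge0.
  rewrite /B -(subnKC (ltnW NL)) big_split_ord /= -addrA lerDl.
  by apply: addr_ge0; [exact: sumr_ge0|rewrite mulr_ge0].
exists lam, B; split => //; first exact: ltW.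
move=> N x; apply: (@le_trans _ _ (\sum_(n < N) q n * expR (lam * `|x|))).
  apply: ler_sum => n _; rewrite /q -[leRHS]mulrA ler_wpM2l ?hermite_le//.
  by rewrite divr_ge0 ?exprn_ge0.
by rewrite -mulr_suml ler_wpM2r ?expR_ge0.
Qed.

End hermite.

(** * Moments of products of Hermite functions *)

Section hermite_moments.
Context {R : realType} d (Y : measurableType d) (P : {measure set Y -> \bar R}).
Variables (D : nat) (w : 'I_D -> Y -> R) (m : 'I_D -> R).
Hypothesis mw : forall l, measurable_fun setT (w l).
Hypothesis exp_integrable : forall K : R,
  P.-integrable setT (fun y => (expR (K * \sum_l `|w l y|))%:E).
Hypothesis mgf : forall s : 'I_D -> R,
  \int[P]_y \prod_l hermite_exp (s l) 0 (w l y) = \prod_l expR (s l * m l).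

(** The bound is uniform over [|s| <= S], because differentiation under the integral needs one
    dominating function for all nearby parameters. For a fixed order the rate [lam = 1] suffices. *)
Lemma hermite_exp_le (S s : R) (n : nat) (x : R) : `|s| <= S ->
  `|hermite_exp s n x| <=
  hermite_coef_bound 1 n * expR S * expR ((S + 1) * `|x|).
Proof.
move=> sS; rewrite /hermite_exp normrM (ger0_norm (expR_ge0 _)).
apply: (@le_trans _ _ (expR (S * `|x|) *
    (hermite_coef_bound 1 n * expR (S + `|x|)))).
  apply: ler_pM => //.
    rewrite ler_expR (@le_trans _ _ (s * x))//.
      by rewrite gerBl divr_ge0// sqr_ge0.
    by rewrite (le_trans (ler_norm _))// normrM ler_wpM2r.
  apply: (le_trans (hermite_le n (x - s) ltr01)).
  rewrite ler_wpM2l ?hermite_coef_bound_ge0// ler_expR mul1r.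
  by rewrite (le_trans (ler_normB _ _))// addrC lerD.
by rewrite mulrCA -mulrA ler_wpM2l ?hermite_coef_bound_ge0// -!expRD ler_expR; lra.
Qed.

Lemma measurable_hermite_prod (s : 'I_D -> R) (n : 'I_D -> nat) :
  measurable_fun setT (fun y => \prod_l hermite_exp (s l) (n l) (w l y)).
Proof.
apply: measurable_prod => l _.
exact: (measurableT_comp (measurable_hermite_exp _ _)).
Qed.

Lemma hermite_prod_le (S : R) (s : 'I_D -> R) (n : 'I_D -> nat) y :
  (forall l, `|s l| <= S) ->
  `|\prod_l hermite_exp (s l) (n l) (w l y)| <=
  (\prod_l (hermite_coef_bound 1 (n l) * expR S)) *
    expR ((S + 1) * \sum_l `|w l y|).
Proof.
move=> sS; rewrite normr_prod mulr_sumr expR_sum -big_split /=.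
by apply: ler_prod => l _; rewrite normr_ge0 hermite_exp_le.
Qed.

Lemma integrable_hermite_prod (s : 'I_D -> R) (n : 'I_D -> nat) :
  P.-integrable setT
    (fun y => (\prod_l hermite_exp (s l) (n l) (w l y))%:E).
Proof.
pose S := \sum_l `|s l|.
have sS l : `|s l| <= S by rewrite /S (bigD1 l)//= lerDl sumr_ge0.
pose A := \prod_l (hermite_coef_bound 1 (n l) * expR S).
apply: (@le_integrable _ _ _ _ _ _ _
  (fun y => A%:E * (expR ((S + 1) * \sum_l `|w l y|))%:E)%E) => //.
- by apply/measurable_EFinP; exact: measurable_hermite_prod.
- move=> y _; rewrite -EFinM /= lee_fin.
  exact: le_trans (hermite_prod_le _ _ sS) (ler_norm _).
- exact: integrableZl.
Qed.

(* [hermite_exp s n.+1] is the derivative of [hermite_exp s n] in the parameter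
   [s], and likewise on the right-hand side, so the moments follow from the
   generating function by differentiating under the integral sign. *)
Lemma hermite_prod_moment (s : 'I_D -> R) (n : 'I_D -> nat) :
  \int[P]_y \prod_l hermite_exp (s l) (n l) (w l y) =
  \prod_l (m l ^+ n l * expR (s l * m l)).
Proof.
have [k] := ubnP (\sum_l n l)%N; elim: k s n => // k IH s n.
have [/existsP[l nl0]|/existsPn n0] := boolP [exists l, n l != 0%N]; last first.
  move=> _; have {}n0 l : n l = 0%N by apply/eqP; rewrite -[_ == _]negbK.
  under eq_Rintegral do under eq_bigr do rewrite n0.
  by rewrite mgf; apply: eq_bigr => l _; rewrite n0 expr0 mul1r.
case nl: (n l) nl0 => [//|q] _ nk.
pose n' j := if j == l then q else n j.
have n'k : (\sum_l n' l < k)%N.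
  rewrite -ltnS; apply: leq_trans nk; rewrite ltnS.
  rewrite (bigD1 l)//= [X in (_ <= X)%N](bigD1 l)//= nl /n' eqxx ltnS leq_add2l.
  by apply: leq_sum => j /negbTE ->.
(* Only the parameter at [l] varies; the other factors are collected in [Q] for the integrand and in
   [T] for the value, both independent of [x]. *)
pose s' x j := if j == l then x else s j.
pose f (x : R) y := \prod_j hermite_exp (s' x j) (n' j) (w j y).
pose Q y := \prod_(j | j != l) hermite_exp (s j) (n j) (w j y).
have fE x y : f x y = hermite_exp x q (w l y) * Q y.
  rewrite /f (bigD1 l)//= /s' /n' eqxx; congr (_ * _).
  by apply: eq_bigr => j /negbTE ->.
pose T := \prod_(j | j != l) (m j ^+ n j * expR (s j * m j)).
have FE x : \int[P]_y f x y = m l ^+ q * expR (x * m l) * T.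
  rewrite IH// (bigD1 l)//= /s' /n' eqxx; congr (_ * _).
  by apply: eq_bigr => j /negbTE ->.
have derf (x : R) (y : Y) : is_derive x (1 : R) (f^~ y) (hermite_exp x q.+1 (w l y) * Q y).
  rewrite [X in is_derive _ _ X](_ : _ =
    (fun x => hermite_exp x q (w l y)) * cst (Q y)); last exact/funext.
  apply: (is_derive_eq (is_deriveM (is_derive_hermite_exp _ _ _) (is_derive_cst _ _ _))).
  by rewrite scaler0 add0r /GRing.scale /= mulrC.
have d1E x y : partial1of2 f x y = hermite_exp x q.+1 (w l y) * Q y.
  by rewrite partial1of2E; have dfx := derf x y; rewrite derive_val.
(* The added 1 is the radius of the interval around [s l] on which the parameter moves, so [S]
   bounds every parameter throughout it. *)
pose S := \sum_j `|s j| + 1.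
have sj j : `|s j| <= \sum_i `|s i| by rewrite (bigD1 j)//= lerDl sumr_ge0.
have sS x j : `|x - s l| < 1 -> `|s' x j| <= S.
  move=> xs; rewrite /s' /S; case: eqP => [_|_]; last by have := sj j; lra.
  by have := ler_normD (x - s l) (s l); rewrite subrK; have := sj l; lra.
pose n'' j := if j == l then q.+1 else n j.
have gE x y : hermite_exp x q.+1 (w l y) * Q y =
    \prod_j hermite_exp (s' x j) (n'' j) (w j y).
  rewrite [RHS](bigD1 l)//= /s' /n'' eqxx; congr (_ * _).
  by apply: eq_bigr => j /negbTE ->.
pose A := \prod_j (hermite_coef_bound 1 (n'' j) * expR S).
have A0 : 0 <= A.
  by apply: prodr_ge0 => j _; rewrite mulr_ge0 ?expR_ge0 ?hermite_coef_bound_ge0.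
have sl1 : `]s l - 1, s l + 1[%classic (s l).
  by rewrite /= in_itv /=; apply/andP; split; lra.
have itvP x : `]s l - 1, s l + 1[%classic x -> `|x - s l| < 1.
  by rewrite /= in_itv /= => /andP[? ?]; rewrite ltr_norml; apply/andP; split; lra.
pose G y := A * expR ((S + 1) * \sum_j `|w j y|).
have dF := @differentiation_under_integral R _ Y P f setT measurableT (s l)
  (s l - 1) (s l + 1) sl1.
have {}dF : derive1 (fun x => \int[P]_y f x y) (s l) =
    \int[P]_y partial1of2 f (s l) y.
  apply: (dF _ _ G).
  - by move=> x _; exact: integrable_hermite_prod.
  - by move=> x y _ _; have dfx := derf x y.
  - by move=> y; rewrite mulr_ge0 ?expR_ge0.
  - have -> : EFin \o G =
        (fun y => A%:E * (expR ((S + 1) * \sum_l `|w l y|))%:E)%E by exact/funext.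
    exact: integrableZl.
  - by move=> x y /itvP xs _; rewrite d1E gE hermite_prod_le// => j; exact: sS.
transitivity (\int[P]_y partial1of2 f (s l) y).
  apply: eq_Rintegral => y _; rewrite d1E (bigD1 l)//= nl; congr (_ * _).
have -> : \prod_j (m j ^+ n j * expR (s j * m j)) =
    m l ^+ q.+1 * expR (s l * m l) * T by rewrite (bigD1 l)//= nl.
rewrite -dF derive1E (_ : (fun x : R => \int[P]_y f x y) =
    cst (m l ^+ q) * (expR \o (fun x => x * m l)) * cst T); last first.
  by apply/funext => x; rewrite FE.
have dlin : is_derive (s l) (1 : R) (fun x => x * m l) (m l).
  have dX := is_deriveM (is_derive_id (s l) 1) (is_derive_cst (m l : R) (s l) 1).
  by apply: (is_derive_eq dX); rewrite scaler0 add0r /GRing.scale /= mulr1.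
have dexp := is_derive1_comp (is_derive_expR _) dlin.
have dall := is_deriveM (is_deriveM (is_derive_cst (m l ^+ q : R) (s l) (1 : R)) dexp)
  (is_derive_cst T (s l) (1 : R)).
by rewrite derive_val /GRing.scale /= exprS; ring.
Qed.

End hermite_moments.

(** * Nonnegative sums over a countable type *)

Section countable_sum.
Context {R : realType} (T : countType).
Local Open Scope ereal_scope.

Lemma esum_countE (a : T -> \bar R) : (forall p, 0 <= a p) ->
  \esum_(p in [set: T]) a p =
  \sum_(n <oo) (if pickle_inv n is Some p then a p else 0).
Proof.
move=> a0; pose b n := if @pickle_inv T n is Some p then a p else 0.
have b0 n : 0 <= b n by rewrite /b; case: pickle_inv.
rewrite nneseries_esumT//.
transitivity (\esum_(p in [set: T]) b (pickle p)).
  by apply: eq_esum => p _; rewrite /b pickleK_inv.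
rewrite -esum_image; last by move=> p q _ _ /(pcan_inj pickleK_inv).
rewrite esum_mkcond; apply: eq_esum => n _; case: ifPn => // /negP nP.
rewrite -/(b n) /b; case E: pickle_inv => [p|//]; exfalso; apply: nP.
by rewrite inE; exists p => //; have := @pickle_invK T n; rewrite E.
Qed.

Lemma esumZl (a : T -> \bar R) (c : R) : (0 <= c)%R -> (forall p, 0 <= a p) ->
  \esum_(p in [set: T]) (c%:E * a p) = c%:E * \esum_(p in [set: T]) a p.
Proof.
move=> c0 a0; rewrite !esum_countE//; last by move=> p; exact: mule_ge0.
rewrite -nneseriesZl//; last by move=> n _; case: pickle_inv.
by apply: eq_eseriesr => n _; case: pickle_inv => //; rewrite mule0.
Qed.

Context d (Y : measurableType d) (P : {measure set Y -> \bar R}).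

Lemma measurable_esum (f : T -> Y -> \bar R) :
  (forall p, measurable_fun setT (f p)) -> (forall p y, 0 <= f p y) ->
  measurable_fun setT (fun y => \esum_(p in [set: T]) f p y).
Proof.
move=> mf f0; under eq_fun do rewrite esum_countE//.
apply: (@ge0_emeasurable_sum _ _ _ _
  (fun n y => if pickle_inv n is Some p then f p y else 0) xpredT).
  by move=> n y _ _; case: pickle_inv.
by move=> n _; case: pickle_inv.
Qed.

Lemma integral_esum (f : T -> Y -> \bar R) :
  (forall p, measurable_fun setT (f p)) -> (forall p y, 0 <= f p y) ->
  \int[P]_y (\esum_(p in [set: T]) f p y) =
  \esum_(p in [set: T]) (\int[P]_y f p y).
Proof.
move=> mf f0; under eq_integral do rewrite esum_countE//.
rewrite esum_countE; last by move=> p; exact: integral_ge0.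
rewrite integral_nneseries//; last 2 first.
- by move=> n; case: pickle_inv.
- by move=> n y _; case: pickle_inv.
by apply: eq_eseriesr => n _; case: pickle_inv => //; rewrite integral0.
Qed.

End countable_sum.

(** * Absolutely convergent real sums and their exchange with the integral *)

Section absolute_sum.
Context {R : realType} (T : countType).

(* [Defs.msum] unfolds to [csum] on multi-indices; unqualified, [msum] would
   denote the library's finite sum of measures. *)
Definition csum (f : T -> R) : R :=
  fine (\esum_(p in [set: T]) (Num.max (f p) 0)%:E
      - \esum_(p in [set: T]) (Num.max (- f p) 0)%:E)%E.

(** Summability makes both halves of [csum] finite, so multiplication distributes over their
    difference; a nonnegative [c] commutes with taking positive and negative parts. *)
Lemma csumZl (c : R) (f : T -> R) : 0 <= c ->
  (\esum_(p in [set: T]) `|f p|%:E < +oo)%E ->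
  csum (fun p => c * f p) = c * csum f.
Proof.
move=> c0 fy; rewrite /csum -[c in RHS]/(fine c%:E).
have fin (g : T -> R) : (forall p, 0 <= g p <= `|f p|) ->
    (\esum_(p in [set: T]) (g p)%:E)%E \is a fin_num.
  move=> gf; rewrite ge0_fin_numE; last first.
    by apply: esum_ge0 => p _; rewrite lee_fin; case/andP: (gf p).
  by apply: le_lt_trans fy; apply: le_esum => p _; rewrite lee_fin; case/andP: (gf p).
have fin1 : (\esum_(p in [set: T]) (Num.max (f p) 0)%:E)%E \is a fin_num.
  by apply: fin => p; rewrite le_max lexx orbT ge_max ler_norm normr_ge0.
have fin2 : (\esum_(p in [set: T]) (Num.max (- f p) 0)%:E)%E \is a fin_num.
  by apply: fin => p; rewrite le_max lexx orbT ge_max -normrN ler_norm normr_ge0.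
rewrite -fineM ?fin_numB ?fin1 ?fin2// muleBr ?fin_num_adde_defr//.
rewrite -!esumZl//; last 2 first.
- by move=> p; rewrite lee_fin le_max lexx orbT.
- by move=> p; rewrite lee_fin le_max lexx orbT.
by congr (fine (_ - _)%E); apply: eq_esum => p _; rewrite -EFinM maxr_pMr// mulr0 ?mulrN.
Qed.

Context d (Y : measurableType d) (P : {measure set Y -> \bar R}).
Variables (f : T -> Y -> R) (B : Y -> R).
Hypothesis mf : forall p, measurable_fun setT (f p).
Hypothesis fB : forall y, (\esum_(p in [set: T]) `|f p y|%:E <= (B y)%:E)%E.

Let pos p y : \bar R := (Num.max (f p y) 0)%:E.
Let neg p y : \bar R := (Num.max (- f p y) 0)%:E.

Let pos_ge0 p y : (0 <= pos p y)%E.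
Proof. by rewrite lee_fin le_max lexx orbT. Qed.

Let neg_ge0 p y : (0 <= neg p y)%E.
Proof. by rewrite lee_fin le_max lexx orbT. Qed.

Let mpos p : measurable_fun setT (pos p).
Proof. by apply/measurable_EFinP; exact: measurable_maxr. Qed.

Let mneg p : measurable_fun setT (neg p).
Proof.
by apply/measurable_EFinP; apply: measurable_maxr => //; exact: measurableT_comp.
Qed.

Let esum_pos_le y : (\esum_(p in [set: T]) pos p y <= (B y)%:E)%E.
Proof.
apply: le_trans (fB y); apply: le_esum => p _.
by rewrite lee_fin ge_max ler_norm normr_ge0.
Qed.

Let esum_neg_le y : (\esum_(p in [set: T]) neg p y <= (B y)%:E)%E.
Proof.
apply: le_trans (fB y); apply: le_esum => p _.
by rewrite lee_fin ge_max -normrN ler_norm normr_ge0.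
Qed.

Let fin_pos y : (\esum_(p in [set: T]) pos p y)%E \is a fin_num.
Proof.
by rewrite ge0_fin_numE ?esum_ge0// (le_lt_trans (esum_pos_le y))// ltry.
Qed.

Let fin_neg y : (\esum_(p in [set: T]) neg p y)%E \is a fin_num.
Proof.
by rewrite ge0_fin_numE ?esum_ge0// (le_lt_trans (esum_neg_le y))// ltry.
Qed.

Lemma measurable_csum : measurable_fun setT (fun y => csum (f^~ y)).
Proof.
apply: (measurableT_comp (f := @fine R)) => //.
by apply: emeasurable_funB; exact: measurable_esum.
Qed.

Lemma csum_le y : `|csum (f^~ y)| <= B y.
Proof.
have pB := esum_pos_le y; have nB := esum_neg_le y.
have p0 : (0 <= \esum_(p in [set: T]) pos p y)%E by exact: esum_ge0.
have n0 : (0 <= \esum_(p in [set: T]) neg p y)%E by exact: esum_ge0.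
rewrite /csum -/(pos^~ y) -/(neg^~ y).
move: (fin_pos y) (fin_neg y) pB nB p0 n0.
case: (esum _ (pos^~ y)) => // u _; case: (esum _ (neg^~ y)) => // v _.
by rewrite !lee_fin => *; rewrite /= ler_norml; apply/andP; split; lra.
Qed.

Hypothesis intB : P.-integrable setT (EFin \o B).

Lemma Rintegral_csum :
  \int[P]_y csum (f^~ y) = csum (fun p => \int[P]_y f p y).
Proof.
have ipos : P.-integrable setT (fun y => \esum_(p in [set: T]) pos p y)%E.
  apply: le_integrable intB => //; first exact: measurable_esum.
  move=> y _ /=; rewrite gee0_abs ?esum_ge0//.
  by rewrite (le_trans (esum_pos_le y))// lee_fin ler_norm.
have ineg : P.-integrable setT (fun y => \esum_(p in [set: T]) neg p y)%E.
  apply: le_integrable intB => //; first exact: measurable_esum.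
  move=> y _ /=; rewrite gee0_abs ?esum_ge0//.
  by rewrite (le_trans (esum_neg_le y))// lee_fin ler_norm.
have spos : summable [set: T] (fun p => \int[P]_y pos p y)%E.
  rewrite /summable (eq_esum (b := fun p => \int[P]_y pos p y)%E); last first.
    by move=> p _; rewrite gee0_abs// integral_ge0.
  by rewrite -integral_esum//; exact: integrable_lty.
have sneg : summable [set: T] (fun p => \int[P]_y neg p y)%E.
  rewrite /summable (eq_esum (b := fun p => \int[P]_y neg p y)%E); last first.
    by move=> p _; rewrite gee0_abs// integral_ge0.
  by rewrite -integral_esum//; exact: integrable_lty.
have ip p : (\int[P]_y pos p y)%E \is a fin_num.
  by rewrite fin_num_abs (summable_pinfty spos).
have inn p : (\int[P]_y neg p y)%E \is a fin_num.
  by rewrite fin_num_abs (summable_pinfty sneg).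
have -> : \int[P]_y csum (f^~ y) = fine
    (\esum_(p in [set: T]) (\int[P]_y pos p y)
     - \esum_(p in [set: T]) (\int[P]_y neg p y))%E.
  rewrite -!integral_esum// -integralB//; congr fine; apply: eq_integral => y _.
  by rewrite /csum fineK// fin_numB fin_pos fin_neg.
have h p : (\int[P]_y f p y)%:E = ((\int[P]_y pos p y) - (\int[P]_y neg p y))%E.
  have e : (\int[P]_y (f p y)%:E = \int[P]_y pos p y - \int[P]_y neg p y)%E.
    rewrite integralE; congr (_ - _)%E; apply: eq_integral => y _.
      by rewrite funeposE /pos EFin_max.
    by rewrite funenegE /neg EFin_max.
  by rewrite /Rintegral e fineK// fin_numB ip inn.
(* The positive part of an integral is in general not the integral of the positive part; only the
   differences of the two sums coincide. *)
rewrite -esumB//; [|by move=> p _; exact: integral_ge0..].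
rewrite /csum; congr (fine (_ - _)%E); apply: eq_esum => p _.
  by rewrite funeposE -h EFin_max.
by rewrite funenegE -h EFin_max.
Qed.

End absolute_sum.

(** * Factorised bounds for sums over multi-indices *)

Section multi_index.
Context {R : realType}.

(** Any finite set of multi-indices lies in a box, and over a box the sum of products is the product
    of the sums. *)
Lemma esum_mindex_prod_le (D : nat) (f : 'I_D -> nat -> R) (b : 'I_D -> R) :
  (forall l n, 0 <= f l n) -> (forall l N, \sum_(n < N) f l n <= b l) ->
  (\esum_(p in [set: mindex D]) (\prod_l f l (p l))%:E <= (\prod_l b l)%:E)%E.
Proof.
move=> f0 fb; apply: ge_ereal_sup => _ [X [finX _] <-].
rewrite fsbig_finite//= sumEFin lee_fin; set F := finmap.enum_fset (fset_set X).
pose N := (\max_(p <- F) \max_l p l)%N.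
pose emb (h : {ffun 'I_D -> 'I_N.+1}) : mindex D := [ffun l => h l : nat].
have emb_inj : injective emb.
  move=> h1 h2 /ffunP e; apply/ffunP => l; apply: val_inj.
  by have := e l; rewrite !ffunE.
pose s := [seq emb h | h <- index_enum {ffun 'I_D -> 'I_N.+1}].
have us : uniq s by rewrite map_inj_uniq// index_enum_uniq.
have Fs p : p \in F -> p \in s.
  move=> pF; apply/mapP; exists [ffun l => inord (p l)].
    by rewrite mem_index_enum.
  apply/ffunP => l; rewrite !ffunE inordK// ltnS.
  apply: (@leq_trans (\max_l p l)%N); first exact: (leq_bigmax l).
  by rewrite /N; apply: leq_bigmax_seq.
have -> : \sum_(p <- F) \prod_l f l (p l) =
    \sum_(p <- s | p \in F) \prod_l f l (p l).
  rewrite -[RHS]big_filter; apply: perm_big; apply: uniq_perm.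
  - exact: finmap.fset_uniq.
  - exact: filter_uniq.
  - by move=> p; rewrite mem_filter; case: (boolP (p \in F)) => // /Fs ->.
apply: (@le_trans _ _ (\sum_(p <- s) \prod_l f l (p l))).
  rewrite big_mkcond; apply: ler_sum => p _; case: ifP => // _.
  exact: prodr_ge0.
rewrite big_map; under eq_bigr do under eq_bigr do rewrite ffunE.
rewrite -(bigA_distr_bigA (fun l (n : 'I_N.+1) => f l n)).
by apply: ler_prod => l _; rewrite fb andbT; exact: sumr_ge0.
Qed.

End multi_index.

(** * The Hermite series and its mean *)

Section hermite_series.
Context {R : realType} d (Y : measurableType d) (P : {measure set Y -> \bar R}).
Variables (D : nat) (w : 'I_D -> Y -> R) (m : 'I_D -> R).
Hypothesis mw : forall l, measurable_fun setT (w l).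
Variables (a : mindex D -> R) (C : R) (s : 'I_D -> R).
Hypothesis C0 : 0 <= C.
Hypothesis aC : forall p, `|a p| <= C ^+ mabs p.

Let term p y := a p / (mfact p)%:R * \prod_l hermite_exp (s l) (p l) (w l y).

Definition hermite_series (y : Y) : R :=
  Defs.msum (fun p : mindex D => a p / (mfact p)%:R * \prod_l hermite_exp (s l) (p l) (w l y)).

Let mterm p : measurable_fun setT (term p).
Proof. by apply: measurable_funM => //; exact: measurable_hermite_prod. Qed.

Lemma mabs_mfact_prod p : C ^+ mabs p / (mfact p)%:R =
  \prod_(l < D) (C ^+ p l / (p l)`!%:R) :> R.
Proof. by rewrite prodf_div expr_sum natr_prod. Qed.

(** The growth condition on [a] gives a majorant that factors over the coordinates, and
    [hermite_egf_le] at [w l y - s l] bounds each factor. *)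
Lemma hermite_series_abs_le : exists A K : R, forall y,
  (\esum_(p in [set: mindex D]) `|term p y|%:E <=
   (A * expR (K * \sum_l `|w l y|))%:E)%E.
Proof.
have [lam [B [lam0 B0 hB]]] := hermite_egf_le C0.
pose S := \sum_l `|s l|.
have sS l : `|s l| <= S by rewrite /S (bigD1 l)//= lerDl sumr_ge0.
exists (\prod_(l < D) (B * expR (lam * S))), (S + lam) => y.
apply: (@le_trans _ _ (\esum_(p in [set: mindex D])
    (\prod_l (C ^+ p l / (p l)`!%:R * `|hermite_exp (s l) (p l) (w l y)|))%:E)%E).
  apply: le_esum => p _; rewrite lee_fin big_split /= -mabs_mfact_prod.
  rewrite /term normrM normr_prod ler_wpM2r ?prodr_ge0//.
  by rewrite normrM normfV normr_nat ler_wpM2r.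
rewrite [(S + lam) * _]mulr_sumr expR_sum -big_split /=.
apply: (@esum_mindex_prod_le R D
  (fun l n => C ^+ n / n`!%:R * `|hermite_exp (s l) n (w l y)|)) => l.
  by move=> n; rewrite mulr_ge0 ?divr_ge0 ?exprn_ge0.
move=> N; apply: (@le_trans _ _ (expR (S * `|w l y|) *
    (B * expR (lam * (`|w l y| + S))))).
  under eq_bigr => n _ do rewrite /hermite_exp normrM (ger0_norm (expR_ge0 _)) mulrCA.
  rewrite -mulr_sumr; apply: ler_pM => //.
  - by apply: sumr_ge0 => n _; rewrite mulr_ge0 ?divr_ge0 ?exprn_ge0.
  - rewrite ler_expR (@le_trans _ _ (s l * w l y))//.
      by rewrite gerBl divr_ge0// sqr_ge0.
    by rewrite (le_trans (ler_norm _))// normrM ler_wpM2r.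
  - apply: (le_trans (hB _ _)); rewrite ler_wpM2l// ler_expR ler_wpM2l//.
    by rewrite (le_trans (ler_normB _ _))// lerD.
by rewrite mulrCA -!mulrA ler_wpM2l// -!expRD ler_expR; lra.
Qed.

Lemma measurable_hermite_series : measurable_fun setT hermite_series.
Proof. exact: measurable_csum mterm. Qed.

Lemma hermite_series_le : exists A K : R, forall y,
  `|hermite_series y| <= A * expR (K * \sum_l `|w l y|).
Proof.
have [A [K AK]] := hermite_series_abs_le; exists A, K => y.
exact: (csum_le AK).
Qed.

Hypothesis exp_integrable : forall K : R,
  P.-integrable setT (fun y => (expR (K * \sum_l `|w l y|))%:E).
Hypothesis mgf : forall s : 'I_D -> R,
  \int[P]_y \prod_l hermite_exp (s l) 0 (w l y) = \prod_l expR (s l * m l).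

(** The exponential majorant allows termwise integration; every moment then carries the same factor
    exp(sum of s_l m_l), which is pulled out of the sum. *)
Lemma Rintegral_hermite_series : \int[P]_y hermite_series y =
  expR (\sum_l s l * m l) *
  Defs.msum (fun p : mindex D => a p / (mfact p)%:R * \prod_l m l ^+ p l).
Proof.
have [A [K AK]] := hermite_series_abs_le.
have intB : P.-integrable setT (EFin \o (fun y => A * expR (K * \sum_l `|w l y|))).
  have -> : EFin \o (fun y => A * expR (K * \sum_l `|w l y|)) =
      (fun y => A%:E * (expR (K * \sum_l `|w l y|))%:E)%E by exact/funext.
  exact: integrableZl.
rewrite [LHS](Rintegral_csum mterm AK intB).
rewrite -[RHS](@csumZl R (mindex D)) ?expR_ge0//.
  congr csum; apply/funext => p; rewrite /term RintegralZl//; last first.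
    exact: integrable_hermite_prod.
  by rewrite (hermite_prod_moment mw exp_integrable mgf) big_split /= -expR_sum; ring.
(* The resulting power series converges absolutely, being dominated by a product of exponential
   series in [C * |m l|]. *)
pose c : 'I_D -> R := fun l => expR (C * `|m l|).
apply: (@le_lt_trans _ _ (\prod_l c l)%:E); last exact: ltry.
apply: le_trans (@esum_mindex_prod_le R D
  (fun l n => (C * `|m l|) ^+ n / n`!%:R) c _ _).
- apply: le_esum => p _; rewrite lee_fin normrM normr_prod.
  under eq_bigr do rewrite normrX.
  under [leRHS]eq_bigr do rewrite exprMn mulrAC.
  rewrite [leRHS]big_split /= -mabs_mfact_prod ler_wpM2r ?prodr_ge0//.
  by rewrite normrM normfV normr_nat ler_wpM2r.
- by move=> l n; rewrite divr_ge0 ?exprn_ge0 ?mulr_ge0.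
- by move=> l N; rewrite exp_partial_sum_le ?mulr_ge0.
Qed.

End hermite_series.

(** * Moments of exponentially bounded functions *)

Section exp_bounded.
Context {R : realType} (n : nat).
Implicit Types f : n.-tuple R -> R.

Lemma exp_bounded_ge0 f : exp_bounded f ->
  exists A K : R, [/\ 0 <= A, 0 <= K & forall t, `|f t| <= A * expR (K * norm1 t)].
Proof.
move=> [A [K fAK]]; exists `|A|, `|K|; split => // t; apply: le_trans (fAK t) _.
apply: ler_pM => //; rewrite ?ler_norm ?ler_expR//; last first.
  by rewrite ler_wpM2r ?norm1_ge0 ?ler_norm.
(* [A] is nonnegative, since a positive multiple of it dominates [|f t|]. *)
have := fAK t; have := normr_ge0 (f t) => h1 h2.
by rewrite -(pmulr_lge0 _ (expR_gt0 (K * norm1 t))) (le_trans h1 h2).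
Qed.

Lemma exp_bounded_norm f : exp_bounded f -> exp_bounded (fun t => `|f t|).
Proof. by move=> [A [K h]]; exists A, K => t; rewrite normr_id. Qed.

Lemma exp_bounded_sqrB f (e : R) :
  exp_bounded f -> exp_bounded (fun t => (f t - e) ^+ 2).
Proof.
move=> /exp_bounded_ge0[A [K [A0 K0 fAK]]].
exists ((A + `|e|) ^+ 2), (2 * K) => t.
have -> : expR (2 * K * norm1 t) = expR (K * norm1 t) ^+ 2.
  by rewrite expr2 -expRD; congr expR; ring.
(* Since [K >= 0] the exponential is at least 1, so the constant [e] can be absorbed into it. *)
have e1 : 1 <= expR (K * norm1 t) by rewrite -expR0 ler_expR mulr_ge0 ?norm1_ge0.
rewrite normrX -exprMn lerXn2r ?nnegrE ?mulr_ge0 ?addr_ge0 ?expR_ge0//.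
rewrite (le_trans (ler_normB _ _))// mulrDl lerD// -[leLHS]mulr1.
by rewrite ler_wpM2l.
Qed.

Lemma gauss_iter_exp_bounded_lty (s : R) (m : n.-tuple R) f : s != 0 ->
  measurable_fun setT f -> exp_bounded f -> (forall t, 0 <= f t) ->
  (gauss_iter s m (EFin \o f) < +oo)%E.
Proof.
move=> s0 mf /exp_bounded_ge0[A [K [A0 K0 fAK]]] f0.
have [P [P1 P2 _]] := exists_gauss_measure m s0.
have mE : measurable_fun setT (fun t : n.-tuple R => (expR (K * norm1 t))%:E).
  by apply/measurable_EFinP; exact: measurable_expR_norm1.
rewrite P1//; last exact/measurable_EFinP.
apply: (@le_lt_trans _ _ (\int[P]_t (A%:E * (expR (K * norm1 t))%:E))%E).
  apply: ge0_le_integral => //.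
  - by move=> t _; rewrite lee_fin.
  - exact/measurable_EFinP.
  - exact: measurable_funeM.
  - by move=> t _; rewrite -EFinM lee_fin (le_trans _ (fAK t))// ler_norm.
by rewrite ge0_integralZl// lte_mul_pinfty// P2.
Qed.

End exp_bounded.

(** * The estimator built on the projected observation *)

Section projected_estimator.
Context {R : realType} (M D : nat) (U : 'M[R]_(M, D)) (sigma : R).
Hypothesis UTU : U^T *m U = 1%:M.
Hypothesis sigma_gt0 : 0 < sigma.

Definition projection (l : 'I_D) (t : M.-tuple R) : R :=
  (U^T *m tup2col t) l 0 / sigma.

Lemma projectionE l t : projection l t = (\sum_j U j l * tnth t j) / sigma.
Proof. by rewrite /projection mxE; congr (_ / _); apply: eq_bigr => j _; rewrite !mxE. Qed.

Lemma measurable_projection l : measurable_fun setT (projection l).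
Proof.
rewrite (_ : projection l = fun t => (\sum_j U j l * tnth t j) / sigma); last first.
  by apply/funext => t; rewrite projectionE.
apply: measurable_funM => //; apply: measurable_sum => j.
by apply: measurable_funM => //; exact: measurable_tnth.
Qed.

Lemma sum_projection_le : exists2 c : R, 0 <= c & forall t,
  \sum_l `|projection l t| <= c * norm1 t.
Proof.
exists (\sum_l \sum_j `|U j l| / sigma).
  by apply: sumr_ge0 => l _; apply: sumr_ge0 => j _; rewrite divr_ge0// ltW.
move=> t; rewrite mulr_suml; apply: ler_sum => l _.
rewrite projectionE normrM normfV (gtr0_norm sigma_gt0) -mulr_suml mulrAC.
rewrite ler_wpM2r ?invr_ge0 ?(ltW sigma_gt0)// mulr_suml.
rewrite (le_trans (ler_norm_sum _ _ _))//; apply: ler_sum => j _.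
by rewrite normrM ler_wpM2l// /norm1 (bigD1 j)//= lerDl sumr_ge0.
Qed.

Lemma exp_bounded_projection (f : M.-tuple R -> R) (A K : R) :
  (forall t, `|f t| <= A * expR (K * \sum_l `|projection l t|)) ->
  exp_bounded f.
Proof.
have [c c0 hc] := sum_projection_le.
move=> fAK; exists `|A|, (`|K| * c) => t; apply: le_trans (fAK t) _.
apply: (@le_trans _ _ (`|A| * expR (K * \sum_l `|projection l t|))).
  by rewrite ler_wpM2r ?expR_ge0 ?ler_norm.
rewrite ler_wpM2l// ler_expR -mulrA.
apply: (@le_trans _ _ (`|K| * \sum_l `|projection l t|)).
  by rewrite ler_wpM2r ?ler_norm ?sumr_ge0.
by rewrite ler_wpM2l.
Qed.

Lemma sum_sqr_orthonormal (s : 'I_D -> R) :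
  \sum_j (\sum_l U j l * s l) ^+ 2 = \sum_l s l ^+ 2.
Proof.
pose v : 'cV[R]_D := \col_l s l.
have sqrE k (x : 'cV[R]_k) : (x^T *m x) 0 0 = \sum_i x i 0 ^+ 2.
  by rewrite mxE; apply: eq_bigr => i _; rewrite mxE expr2.
transitivity (((U *m v)^T *m (U *m v)) 0 0).
  rewrite sqrE; apply: eq_bigr => j _; rewrite mxE; congr (_ ^+ 2).
  by apply: eq_bigr => l _; rewrite mxE.
rewrite trmx_mul mulmxA -(mulmxA v^T) UTU mulmx1 sqrE.
by apply: eq_bigr => l _; rewrite mxE.
Qed.

(** The exponent is linear in [t] with weights [v] = U s / sigma. As [U] preserves norms, the
    Gaussian variance term equals half the squared norm of [s] and cancels the terms -s_l^2/2 inside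
    [hermite_exp]. *)
Lemma gauss_iter_projection_mgf (m : M.-tuple R) (s : 'I_D -> R) :
  gauss_iter sigma m
    (fun t => (\prod_l hermite_exp (s l) 0 (projection l t))%:E) =
  (\prod_l expR (s l * projection l m))%:E.
Proof.
have sigmaN0 : sigma != 0 by rewrite gt_eqF.
pose v j := (\sum_l U j l * s l) / sigma.
have lin (t : M.-tuple R) :
    \sum_l s l * projection l t = \sum_j v j * tnth t j.
  under eq_bigr do rewrite projectionE mulr_suml mulr_sumr.
  rewrite exchange_big; apply: eq_bigr => j _; rewrite /v !mulr_suml.
  by apply: eq_bigr => l _; ring.
pose c := expR (- (\sum_l s l ^+ 2 / 2)).
transitivity (gauss_iter sigma m
    (fun t => (c * expR (\sum_j v j * tnth t j))%:E)).
  congr gauss_iter; apply/funext => t; congr EFin.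
  rewrite -lin -expRD addrC -sumrB expR_sum; apply: eq_bigr => l _.
  by rewrite /hermite_exp hornerC mulr1.
rewrite gauss_iter_mgf ?expR_ge0//; congr EFin.
rewrite -expR_sum lin -expRD big_split /=; congr expR.
have -> : \sum_j v j ^+ 2 * sigma ^+ 2 / 2 = \sum_l s l ^+ 2 / 2.
  rewrite -!mulr_suml -sum_sqr_orthonormal; congr (_ / _).
  rewrite mulr_suml; apply: eq_bigr => j _.
  by rewrite /v expr_div_n divfK// expf_neq0.
by rewrite [X in _ + X = _]addrC addKr.
Qed.

Variables (a : mindex D -> R) (C : R) (s : 'I_D -> R).
Hypothesis C0 : 0 <= C.
Hypothesis aC : forall p, `|a p| <= C ^+ mabs p.

Let G := hermite_series projection a s.

Lemma measurable_projected_series : measurable_fun setT G.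
Proof. exact: (measurable_hermite_series measurable_projection). Qed.

Lemma exp_bounded_projected_series : exp_bounded G.
Proof.
have [A [K GAK]] := hermite_series_le projection s C0 aC.
exact: exp_bounded_projection GAK.
Qed.

(** [G] does not depend on [m], so a single estimator has the prescribed mean for all parameters at
    once. *)
Lemma gauss_iter_projected_series (m : M.-tuple R) :
  fine (gauss_iter sigma m (EFin \o G)) =
  expR (\sum_l s l * projection l m) *
  Defs.msum (fun p : mindex D => a p / (mfact p)%:R *
    \prod_l projection l m ^+ p l).
Proof.
have sigmaN0 : sigma != 0 by rewrite gt_eqF.
have [P [P1 P2 P3]] := exists_gauss_measure m sigmaN0.
rewrite P3; [|exact: measurable_projected_series|exact: exp_bounded_projected_series].
apply: (Rintegral_hermite_series (P := P)) C0 aC _ _ => //.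
- exact: measurable_projection.
- move=> K; apply/integrableP.
  have mexp : measurable_fun setT (fun t => expR (K * \sum_l `|projection l t|)).
    apply: measurableT_comp => //; apply: measurable_funM => //.
    apply: measurable_sum => l; apply: measurableT_comp => //.
    exact: measurable_projection.
  split; first exact/measurable_EFinP.
  under eq_integral do rewrite gee0_abs//.
  rewrite -P1//; last exact/measurable_EFinP.
  apply: gauss_iter_exp_bounded_lty => //.
  apply: (@exp_bounded_projection _ 1 K) => t.
  by rewrite mul1r ger0_norm ?expR_ge0.
- move=> s'; rewrite /Rintegral -P1 ?gauss_iter_projection_mgf//.
    apply/measurable_EFinP.
    exact: (measurable_hermite_prod measurable_projection).
  move=> t; rewrite lee_fin; apply: prodr_ge0 => l _.
  by rewrite /hermite_exp hornerC mulr1 expR_ge0.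
Qed.

End projected_estimator.

(** * The pseudoinverse in terms of the thin SVD *)

Section thin_svd.
Context {R : realType}.

(** Uniqueness of the pseudoinverse: [A *m B] and [A *m L] are both the orthogonal projection onto
    the range of [A], and [L] cancels [A] on the left. *)
Lemma MP_pinv_left_inverse m n (A : 'M[R]_(m, n)) (B L : 'M[R]_(n, m)) :
  is_MP_pinv A B -> L *m A = 1%:M -> (A *m L)^T = A *m L -> B = L.
Proof.
move=> [ABA BAB ABT _] LA ALT.
have BA : B *m A = 1%:M by rewrite -[B]mul1mx -LA -2!mulmxA (mulmxA A) ABA.
have AB : A *m B = A *m L.
  rewrite -ABT -{1}[A]mulmx1 -LA mulmxA -(mulmxA _ A B) trmx_mul ABT ALT.
  by rewrite mulmxA -(mulmxA A B A) BA mulmx1.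
by rewrite -[B]mul1mx -LA -mulmxA AB mulmxA LA mul1mx.
Qed.

(** Orthonormality of [V] makes [Sig *m V^T] the pseudoinverse, and orthonormality of [U] rewrites
    it as [U^T *m H]. Hence projecting the mean [H *m x] yields [Hp *m x]. *)
Lemma thin_svd_pinv M N D (H : 'M[R]_(M, N)) (U : 'M[R]_(M, D)) (Sig : 'M[R]_D)
    (V : 'M[R]_(N, D)) (Hp : 'M[R]_(D, N)) :
  thin_svd H U Sig V -> is_MP_pinv (V *m invmx Sig) Hp -> Hp = U^T *m H.
Proof.
move=> [UU VV diagS Spos HE] pinv.
have uS : Sig \in unitmx.
  rewrite unitmxE det_trig ?is_diag_mx_is_trig// unitfE.
  by apply/prodf_neq0 => i _; rewrite gt_eqF.
rewrite HE -mulmxA mulmxA UU mul1mx.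
apply: (MP_pinv_left_inverse pinv).
  by rewrite mulmxA -(mulmxA Sig) VV mulmx1 mulmxV.
have -> : V *m invmx Sig *m (Sig *m V^T) = V *m V^T.
  by rewrite mulmxA -(mulmxA V) mulVmx// mulmx1.
by rewrite trmx_mul trmxK.
Qed.

End thin_svd.

(** * Tuples versus columns, and sums with one nonzero term *)

Section coordinates.
Context {R : realType}.

Lemma tup2colK n (t : n.-tuple R) : col2tup (tup2col t) = t.
Proof. by apply: eq_from_tnth => i; rewrite tnth_mktuple mxE. Qed.

Lemma col2tupK n (v : 'cV[R]_n) : tup2col (col2tup v) = v.
Proof. by apply/colP => i; rewrite mxE tnth_mktuple. Qed.

Lemma msum_singleton D (p0 : mindex D) (f : mindex D -> R) :
  (forall p, p != p0 -> f p = 0) -> Defs.msum f = f p0.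
Proof.
move=> f0.
have E (g : R -> R) : g 0 = 0 -> (forall x, 0 <= g x) ->
    (\esum_(p in [set: mindex D]) (g (f p))%:E = (g (f p0))%:E)%E.
  move=> g0 gge0; rewrite -[RHS](@esum_set1 _ _ p0 (fun p => (g (f p))%:E)) ?lee_fin//.
  rewrite [RHS]esum_mkcond; apply: eq_esum => p _; case: ifPn => // pp0.
  rewrite f0 ?g0//; apply: contra pp0 => /eqP ->; exact/mem_set.
rewrite /Defs.msum (E (fun x => Num.max x 0)) ?(E (fun x => Num.max (- x) 0)).
- rewrite -EFinB /=; case: (ler0P (f p0)) => h.
    by rewrite max_l ?oppr_ge0// sub0r opprK.
  by rewrite (max_r (x := - _)) ?oppr_le0 ?subr0 ?ltW.
- by rewrite oppr0 maxxx.
- by move=> x; rewrite le_max lexx orbT.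
- by rewrite maxxx.
- by move=> x; rewrite le_max lexx orbT.
Qed.

End coordinates.

(** * Validity of the bias functions, and the unbiased case for the identity *)

Theorem theorem5 (R : realType) :
  (forall (M N D S : nat) (H : 'M[R]_(M, N)) (U : 'M[R]_(M, D)) (Sig : 'M[R]_D)
     (V : 'M[R]_(N, D)) (Hp : 'M[R]_(D, N)) (sigma : R) (k : 'I_N)
     (x1 : 'cV[R]_D) (C : R) (a : mindex D -> R),
     (1 <= S <= N)%N -> spark_gt H S -> 0 < sigma ->
     \rank H = D -> thin_svd H U Sig V ->
     is_MP_pinv (V *m invmx Sig) Hp ->
     0 <= C -> (forall p, `|a p| <= C ^+ mabs p) ->
     forall x0 : 'cV[R]_N, sparse_set S x0 ->
       valid_bias H sigma S k (bias_c sigma k Hp x1 a) x0)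
  /\
  (forall (N S : nat) (Hp : 'M[R]_(N, N)) (sigma : R) (k : 'I_N),
     (1 <= S <= N)%N -> 0 < sigma ->
     is_MP_pinv ((1%:M : 'M[R]_N) *m invmx (1%:M : 'M[R]_N)) Hp ->
     forall x : 'cV[R]_N, sparse_set S x ->
       bias_c sigma k Hp 0 (fun p => if p == unit_mindex k then sigma else 0) x = 0).
Proof.
split.
  move=> M N D S H U Sig V Hp sigma k x1 C a _ _ sigma0 _ svd pinv C0 aC x0 _.
  have HpE := thin_svd_pinv svd pinv.
  have [UU _ _ _ _] := svd.
  have sigmaN0 : sigma != 0 by rewrite gt_eqF.
  (* The projected mean is [Hp *m x] divided by [sigma]; the factor [sigma] here compensates this in
     the exponent, leaving x_1^T Hp x. *)
  pose s l := sigma * x1 l 0.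
  pose G := hermite_series (projection U sigma) a s.
  have mG : measurable_fun setT G by exact: measurable_projected_series.
  have bG : exp_bounded G := exp_bounded_projected_series U sigma0 s C0 aC.
  exists (fun y => G (col2tup y)); split.
  - by under eq_fun do rewrite tup2colK.
  - move=> x _; rewrite /Egauss; under [X in gauss_iter _ _ X]eq_fun do rewrite tup2colK.
    apply: gauss_iter_exp_bounded_lty => //; first exact: measurableT_comp.
    exact: exp_bounded_norm.
  - rewrite /est_var /Egauss; set e := est_mean _ _ _ _.
    under [X in gauss_iter _ _ X]eq_fun do rewrite tup2colK.
    apply: (@gauss_iter_exp_bounded_lty _ _ _ _ (fun t => (G t - e) ^+ 2)) => //.
    + by apply: measurable_funX; exact: measurable_funB.
    + exact: exp_bounded_sqrB.
    + by move=> t; exact: sqr_ge0.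
  - move=> x _; rewrite /est_bias /bias_c; congr (_ - _).
    rewrite /est_mean /Egauss.
    under [X in gauss_iter _ _ X]eq_fun do rewrite tup2colK.
    rewrite (gauss_iter_projected_series UU sigma0 s C0 aC).
    have projE l : projection U sigma l (col2tup (H *m x)) = (Hp *m x) l 0 / sigma.
      by rewrite /projection col2tupK mulmxA HpE.
    congr (expR _ * _).
      rewrite -mulmxA mxE; apply: eq_bigr => l _.
      by rewrite projE /s !mxE; field.
    congr Defs.msum; apply/funext => p; congr (_ * _).
    by apply: eq_bigr => l _; rewrite projE !mxE mulrC.
move=> N S Hp sigma k _ sigma0 pinv x _.
have -> : Hp = 1%:M.
  by apply: (MP_pinv_left_inverse pinv); rewrite invmx1 !mulmx1 ?trmx1.
rewrite /bias_c trmx0 !mul0mx mxE expR0 mul1r mul1mx.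
(* Only the term at e_k survives; its value sigma * (x_k / sigma) cancels the subtracted x_k. *)
rewrite (msum_singleton (p0 := unit_mindex k)) => [|p /negbTE ->]; last first.
  by rewrite !mul0r.
rewrite eqxx; have -> : mfact (unit_mindex k) = 1%N.
  by apply: big1 => l _; rewrite ffunE; case: eqP.
rewrite divr1 /mpow (bigD1 k)//= ffunE eqxx expr1 big1 => [|l /negbTE lk].
  by rewrite mulr1 mxE; field; rewrite gt_eqF.
by rewrite ffunE lk expr0.
Qed.
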